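(* Let $1\le k\le n$, let $F$ be a shifted family of $k$-subsets of $[n]$, and let $A\neq B$ be members of $F$. Then the Johnson graph $J(F)$ has a Hamilton path with endpoints $A$ and $B$ unless $F$ is a Y-family and $\{A,B\}$ is its universal pair, in which case $J(F)$ has no Hamilton path with endpoints $A$ and $B$.
   Context: $[n]=\{1,\dots,n\}$. A family $F$ of $k$-subsets of $[n]$ is shifted if it is nonempty and whenever $X\in F$, $j\in X$, $i<j$, $i\notin X$, also $(X\setminus\{j\})\cup\{i\}\in F$. (Equivalently, $F$ is a nonempty down-set of the Gale order: for $X=\{x_1<\dots<x_k\}$ and $Y=\{y_1<\dots<y_k\}$, $X\preceq Y$ iff $x_i\le y_i$ for all $i$.) The Johnson graph $J(F)$ has vertex set $F$, with $X,Y$ adjacent iff $|X\triangle Y|=2$. For $k\ge 2$ and integers $r,s$ with $k+2\le r\le n$ and $1\le s\le k-1$, put $$F(k;r,s)=\{[k],\,[k-1]\cup\{k+1\}\}\cup\{[k-1]\cup\{a\}: k+2\le a\le r\}\cup\{[k+1]\setminus\{i\}: s\le i\le k-1\}.$$ A Y-family is a family of the form $F(k;r,s)$ for such parameters. The universal pair of the Y-family $F(k;r,s)$ is $\{[k],\,[k-1]\cup\{k+1\}\}$ (its two Gale-least members, which are the two members adjacent in $J(F)$ to every other member). *)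

(* Defs.v *)
From mathcomp Require Import all_boot.

Set Implicit Arguments.
Unset Strict Implicit.
Unset Printing Implicit Defensive.

(* The ground set {1, ..., n} is modelled by 'I_n; the ordinal x stands for   *)
(* the integer x + 1.                                                         *)
Definition lbl (n : nat) (x : 'I_n) : nat := x.+1.

Definition uniform (n k : nat) (F : {set {set 'I_n}}) : Prop :=
  forall X : {set 'I_n}, X \in F -> #|X| = k.

Definition shifted (n : nat) (F : {set {set 'I_n}}) : Prop :=
  F != set0 /\
  forall (X : {set 'I_n}) (i j : 'I_n),
    X \in F -> j \in X -> lbl i < lbl j -> i \notin X -> i |: (X :\ j) \in F.

Definition symdiff (T : finType) (X Y : {set T}) : {set T} :=
  (X :\: Y) :|: (Y :\: X).

Definition johnson (n : nat) (F : {set {set 'I_n}}) : rel {set 'I_n} :=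
  fun X Y => [&& X \in F, Y \in F & #|symdiff X Y| == 2].

(* In the graph with vertex set V and adjacency e, some Hamilton path runs    *)
(* from x to y; its sequence of vertices is x :: p.                           *)
Definition has_hamilton_path (T : finType) (V : {set T}) (e : rel T)
    (x y : T) : Prop :=
  exists p : seq T,
    [/\ path e x p, last x p = y, uniq (x :: p) & x :: p =i V].

(* The initial segment [m] = {1, ..., m}, intersected with {1, ..., n}.       *)
Definition seg (n m : nat) : {set 'I_n} := [set x : 'I_n | lbl x <= m].

Definition universal_pair (n k : nat) : {set {set 'I_n}} :=
  [set seg n k; seg n k.-1 :|: [set x : 'I_n | lbl x == k.+1]].

Definition Yfam (n k r s : nat) : {set {set 'I_n}} :=
  universal_pair n k
  :|: [set seg n k.-1 :|: [set a] | a : 'I_n & k.+2 <= lbl a <= r]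
  :|: [set seg n k.+1 :\ i | i : 'I_n & s <= lbl i <= k.-1].

Definition Y_family (n k : nat) (F : {set {set 'I_n}}) : Prop :=
  2 <= k /\
  exists r s : nat,
    [/\ k.+2 <= r <= n, 1 <= s <= k.-1 & F = Yfam n k r s].

(* Main.v *)
Require Import Defs.
From mathcomp Require Import all_boot zify.

(** Hamilton paths are built by cutting the family in two.  For [j] in exactly
    one of [A] and [B], the members containing [j] and the members avoiding
    [j] are again shifted on the ground set without [j], and [A], [B] lie in
    different parts.  By induction a path from [A] to [C] in one part and a
    path from [D] to [B] in the other exist as soon as neither pair is
    exceptional, and an edge from [C] to [D] joins them (lemma [linked_join]).

    To cut repeatedly without renumbering, families live on a subset [G] of the
    ground set and agree outside it ([homogeneous], [shifted_on]).  The
    exceptional pairs are described without parameters by [bottleneck]: with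
    [S] the intersection and [U] the union of [A] and [B], both are initial in
    [G], each member contains [S] or lies inside [U], and both kinds of failure
    occur.  A given [A] has at most one such partner ([bottleneck_uniq]), so
    each part has few forbidden ends: of two candidates for [D], one is good
    unless they form the bottleneck themselves, and then all others are good
    ([linked_pair]).

    Let [k] be the common size of the traces on [G].  If [j] has more than [k]
    elements of [G] below it, any good [C] has two neighbours obtained by
    lowering [j]; if these form a bottleneck, a member sticking out of their
    union is a third neighbour ([linked_high]).  If [j] has fewer than [k - 1]
    elements below it, the dual argument applies ([linked_low]).  When no such
    [j] exists, [A] and [B] differ by two consecutive elements [a < b] of ranks
    [k - 1] and [k], and an explicit crossing edge is found unless [A], [B] is a
    bottleneck or all members are pairwise adjacent ([linked_middle]).

    Conversely a bottleneck separates the members not containing [S] from those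
    not inside [U], so no Hamilton path joins its two ends
    ([bottleneck_not_linked]).  On the full ground set, bottlenecks are the
    universal pairs of Y-families ([Y_family_bottleneck]). *)

Set Implicit Arguments.
Unset Strict Implicit.
Unset Printing Implicit Defensive.

(** * Adjacency of sets of equal size *)

Section Adjacency.
Variable T : finType.
Implicit Types X Y S U : {set T}.

Lemma card_diff_eq X Y : #|X| = #|Y| -> #|X :\: Y| = #|Y :\: X|.
Proof. by move=> eXY; rewrite !cardsD setIC eXY. Qed.

Lemma diff_gt0 X Y : #|X| = #|Y| -> X != Y -> 0 < #|X :\: Y|.
Proof.
move=> eXY; apply: contraNT; rewrite -eqn0Ngt cards_eq0 setD_eq0 => sXY.
by rewrite eqEcard sXY eXY leqnn.
Qed.

Lemma adjE X Y : #|X| = #|Y| -> (#|symdiff X Y| == 2) = (#|X :\: Y| == 1).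
Proof.
move=> eXY; rewrite /symdiff cardsU (card_diff_eq eXY).
have -> : (X :\: Y) :&: (Y :\: X) = set0.
  by apply/setP=> z; rewrite !inE; case: (z \in X); case: (z \in Y).
by rewrite cards0; lia.
Qed.

Lemma symdiffC X Y : symdiff X Y = symdiff Y X.
Proof. by rewrite /symdiff setUC. Qed.

Lemma card_swap X i j : j \in X -> i \notin X -> #|i |: (X :\ j)| = #|X|.
Proof.
by move=> jX iX; rewrite cardsU1 !inE (negbTE iX) andbF (cardsD1 j X) jX.
Qed.

Lemma adj_over S X Y : S \subset X -> S \subset Y -> #|X| = #|S|.+1 ->
  #|X| = #|Y| -> X != Y -> #|symdiff X Y| == 2.
Proof.
move=> SX SY cX eXY nXY; rewrite adjE //.
have := diff_gt0 eXY nXY; rewrite cardsD.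
have : #|S| <= #|X :&: Y| by rewrite subset_leq_card // subsetI SX SY.
by lia.
Qed.

Lemma adj_under U X Y : X \subset U -> Y \subset U -> #|U| = #|X|.+1 ->
  #|X| = #|Y| -> X != Y -> #|symdiff X Y| == 2.
Proof.
move=> XU YU cU eXY nXY; rewrite adjE //.
have := diff_gt0 eXY nXY.
have : #|X :|: Y| <= #|U| by rewrite subset_leq_card // subUset XU YU.
have := cardsUI X Y; have := cardsD X Y.
by lia.
Qed.

Lemma adj_swap X i j : j \in X -> i \notin X ->
  #|symdiff X (i |: (X :\ j))| == 2.
Proof.
move=> jX iX; apply: (@adj_over (X :\ j)); rewrite ?subD1set ?subsetUr //.
- by rewrite [LHS](cardsD1 j) jX.
- by rewrite card_swap.
- by apply: contraNneq iX => ->; rewrite setU11.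
Qed.

End Adjacency.

(** * Hamilton paths in families of sets *)

Section Paths.
Variable n : nat.
Implicit Types (A B C D X Y : {set 'I_n}) (F P Q : {set {set 'I_n}}).

Definition linked F A B : Prop := has_hamilton_path F (johnson F) A B.

Lemma johnson_sym F : symmetric (johnson F).
Proof. by move=> X Y; rewrite /johnson symdiffC andbCA. Qed.

Lemma linked_sym F A B : linked F A B -> linked F B A.
Proof.
case=> p [pP <- uP eP]; exists (rev (belast A p)).
have e : last A p :: rev (belast A p) = rev (A :: p).
  by rewrite [A :: p]lastI rev_rcons.
split.
- by rewrite rev_path; apply: sub_path pP => X Y; rewrite johnson_sym.
- by case: (p) => //= x q; rewrite rev_cons last_rcons.
- by rewrite e rev_uniq.
- by move=> X; rewrite e mem_rev eP.
Qed.

Lemma linked1 A : linked [set A] A A.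
Proof. by exists [::]; split=> // X; rewrite !inE. Qed.

Definition slice F (j : 'I_n) (b : bool) : {set {set 'I_n}} :=
  [set X in F | (j \in X) == b].

Lemma slice_sub F j b : slice F j b \subset F.
Proof. by apply/subsetP=> X; rewrite inE => /andP[]. Qed.

Lemma linked_join F j b A B C D :
  linked (slice F j b) A C -> linked (slice F j (~~ b)) B D ->
  #|symdiff C D| == 2 -> linked F A B.
Proof.
move=> [p [pP lP uP eP]] /linked_sym[q [pQ lQ uQ eQ]] adjCD.
have inP X : (X \in A :: p) = (X \in F) && ((j \in X) == b) by rewrite eP inE.
have inQ X : (X \in D :: q) = (X \in F) && ((j \in X) == ~~ b).
  by rewrite eQ inE.
have lift c X s : path (johnson (slice F j c)) X s -> path (johnson F) X s.
  apply: sub_path => Y Z; rewrite /johnson !inE.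
  by case/and3P=> /andP[-> _] /andP[-> _].
exists (p ++ D :: q); split.
- rewrite cat_path (lift _ _ _ pP) /= lP (lift _ _ _ pQ) andbT.
  rewrite /johnson adjCD andbT.
  have /andP[-> _] : (C \in F) && ((j \in C) == b) by rewrite -inP -lP mem_last.
  by have /andP[-> _] : (D \in F) && ((j \in D) == ~~ b) by rewrite -inQ mem_head.
- by rewrite last_cat /= lQ.
- rewrite -cat_cons cat_uniq uP uQ andbT; apply/hasPn=> X.
  by rewrite inP inQ => /andP[_ /eqP->]; case: b {inP inQ pP uP eP pQ uQ eQ}; rewrite andbF.
- move=> X; rewrite -cat_cons mem_cat inP inQ.
  by case: (X \in F); case: (j \in X); case: (b).
Qed.

(** The members other than [A] and [B] may be visited in any order. *)
Lemma linked_clique F A B : A \in F -> B \in F -> A != B ->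
  {in F &, forall X Y, X != Y -> #|symdiff X Y| == 2} -> linked F A B.
Proof.
move=> AF BF nAB cl; pose s := enum (F :\ A :\ B).
have us : uniq (A :: rcons s B).
  rewrite /= rcons_uniq mem_rcons inE (negbTE nAB) !mem_enum !inE !eqxx enum_uniq.
  by rewrite !andbF.
have es : A :: rcons s B =i F.
  move=> X; rewrite inE mem_rcons inE mem_enum !inE.
  by case: eqVneq => [->|_] //=; case: eqVneq => [->|_].
exists (rcons s B); split; rewrite ?last_rcons //.
have : all (mem F) (A :: rcons s B) by apply/allP=> X; rewrite es.
elim: (rcons s B) (A) us => //= Y t IH X /andP[+ uY] /and3P[XF YF tF].
rewrite inE negb_or => /andP[nXY _].
by rewrite /johnson XF YF cl //= IH //= YF.
Qed.

End Paths.

(** * Families shifted on part of the ground set, and their exceptional pairs *)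

Section ShiftedOn.
Variable n : nat.
Implicit Types (A B C D G M S X Y : {set 'I_n}) (F P Q : {set {set 'I_n}}).

Definition shifted_on G F : Prop :=
  forall X (i j : 'I_n), X \in F -> i \in G -> j \in G ->
    j \in X -> i \notin X -> i < j -> i |: (X :\ j) \in F.

(** Members share their part outside [G] instead of being subsets of [G]:
    slices of a family by one element keep this form, on a smaller [G]. *)
Definition homogeneous G F : Prop :=
  {in F &, forall X Y, #|X| = #|Y| /\ X :\: G = Y :\: G}.

Definition initial G M : bool :=
  [forall x in M :&: G, forall y in G :\: M, (x < y)%N].

(** The universal pair of a Y-family, read off from its intersection and its
    union: in a Y-family these are the initial segments of sizes [k - 1] and
    [k + 1], and the two cliques hanging at the pair consist of the members
    not inside the union and of those not containing the intersection. *)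
Definition bottleneck G F A B : bool :=
  [&& #|A :&: B|.+1 == #|A|, #|A :&: B|.+1 == #|B|,
      initial G (A :&: B), initial G (A :|: B),
      [forall X in F, (A :&: B \subset X) || (X \subset A :|: B)],
      [exists X in F, ~~ (A :&: B \subset X)] &
      [exists X in F, ~~ (X \subset A :|: B)]].

Definition linked_off_bottlenecks G F : Prop :=
  {in F &, forall A B, A != B -> ~~ bottleneck G F A B -> linked F A B}.

Lemma initialP G M :
  reflect (forall x y : 'I_n, x \in M -> x \in G -> y \in G -> y \notin M -> x < y)
          (initial G M).
Proof.
apply: (iffP forall_inP) => [h x y xM xG yG yM|h x].
  have xMG : x \in M :&: G by rewrite inE xM.
  by have /forall_inP/(_ y) := h x xMG; apply; rewrite inE yM.
by rewrite inE => /andP[xM xG]; apply/forall_inP=> y /setDP[yG yM]; apply: h.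
Qed.

Lemma homog_ground G F X Y z : homogeneous G F -> X \in F -> Y \in F ->
  z \in X -> z \notin Y -> z \in G.
Proof.
move=> hF XF YF zX zY; have [_ /setP/(_ z)] := hF X Y XF YF.
by rewrite !inE zX (negbTE zY) andbT andbF => /negbT; rewrite negbK.
Qed.

Lemma swap_off G X (i j : 'I_n) : i \in G -> j \in G ->
  (i |: (X :\ j)) :\: G = X :\: G.
Proof.
move=> iG jG; apply/setP=> z; rewrite !inE; case: eqVneq => [->|_]; rewrite ?iG //.
by case: eqVneq => [->|_]; rewrite ?jG.
Qed.

(** Shifting the elements of [X] missing from [M], one at a time, onto the
    elements of [M] missing from [X] turns [X] into [M]; this covers the
    comparisons in the Gale order that occur below. *)
Lemma mem_shift_below G F X M : shifted_on G F -> X \in F ->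
  #|M| = #|X| -> M :\: G = X :\: G ->
  (forall i j : 'I_n, i \in M -> i \notin X -> j \in X -> j \notin M -> i < j) ->
  M \in F.
Proof.
move=> sF; have [m] := ubnP #|M :\: X|.
elim: m X => // m IH X lem XF cMX eMX below.
have [-> //|nMX] := eqVneq M X.
have /card_gt0P[i] := diff_gt0 cMX nMX; rewrite inE => /andP[iX iM].
have /card_gt0P[j] : 0 < #|X :\: M| by apply: diff_gt0; rewrite // eq_sym.
rewrite inE => /andP[jM jX].
have/setP eG := eMX.
have iG : i \in G by have := eG i; rewrite !inE iM (negbTE iX) andbT andbF => /negbFE.
have jG : j \in G.
  by have := eG j; rewrite !inE jX (negbTE jM) andbT andbF => /esym/negbFE.
apply: (IH (i |: (X :\ j))).
- rewrite (cardsD1 i) inE iX iM in lem; move: lem; rewrite add1n ltnS.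
  apply: leq_ltn_trans; apply: subset_leq_card; apply/subsetP=> z; rewrite !inE.
  by case: eqVneq => //= zi; case: eqVneq => [->|] //=; rewrite (negbTE jM) andbF.
- exact: sF XF iG jG jX iX (below i j iM iX jX jM).
- by rewrite card_swap.
- by rewrite swap_off.
move=> x y xM; rewrite !inE negb_or negb_and negbK.
move=> /andP[xi xX] /orP[/eqP->|/andP[yj yX]] yM; first by rewrite iM in yM.
apply: below => //; case/orP: xX => // /eqP ex; by rewrite ex (negbTE jM) in xM.
Qed.

(** Of two distinct initial sets of the same size, each would own an element
    preceding one of the other. *)
Lemma initial_uniq G M M' : initial G M -> initial G M' -> #|M| = #|M'| ->
  M :\: G = M' :\: G -> M = M'.
Proof.
move=> /initialP iM /initialP iM' cMM' eG; apply/eqP; apply/contraT=> nMM'.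
have /card_gt0P[x] := diff_gt0 cMM' nMM'; rewrite inE => /andP[xM' xM].
have /card_gt0P[y] : 0 < #|M' :\: M| by apply: diff_gt0; rewrite // eq_sym.
rewrite inE => /andP[yM yM'].
have xG : x \in G.
  by have/setP/(_ x) := eG; rewrite !inE xM (negbTE xM') andbT andbF => /negbFE.
have yG : y \in G.
  by have/setP/(_ y) := eG; rewrite !inE yM' (negbTE yM) andbT andbF => /esym/negbFE.
by have := iM x y xM xG yG yM; have := iM' y x yM' yG xG xM'; lia.
Qed.

Lemma bottleneck_sym G F A B : bottleneck G F A B = bottleneck G F B A.
Proof. by rewrite /bottleneck ![B :&: _]setIC ![B :|: _]setUC andbCA. Qed.

(** The intersection and the union are initial of prescribed sizes, hence the
    same for both pairs; together with [A] they determine the partner. *)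
Lemma bottleneck_uniq G F A C C' : homogeneous G F ->
  A \in F -> C \in F -> C' \in F ->
  bottleneck G F A C -> bottleneck G F A C' -> C = C'.
Proof.
move=> hF AF CF C'F.
case/and5P=> /eqP c1 /eqP c2 i1 i2 _ /and5P[/eqP c3 /eqP c4 i3 i4 _].
have [[eA eAG] [e' eG']] := (hF _ _ AF CF, hF _ _ AF C'F).
have eI : A :&: C = A :&: C'.
  apply: initial_uniq i1 i3 _ _; first by lia.
  by rewrite !setDIl -eAG -eG'.
have eU : A :|: C = A :|: C'.
  apply: initial_uniq i2 i4 _ _; last by rewrite !setDUl -eAG -eG'.
  have := cardsUI A C; have := cardsUI A C'; lia.
apply/setP=> z; have/setP/(_ z) := eI; have/setP/(_ z) := eU; rewrite !inE.
by case: (z \in A).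
Qed.

(** Only [A] itself and its possible partner are forbidden as far ends.  Two
    distinct candidates can both be forbidden only by being that pair, and then
    every other member is allowed. *)
Lemma linked_pair G F A D1 D2 : linked_off_bottlenecks G F -> homogeneous G F ->
  A \in F -> D1 \in F -> D2 \in F -> D1 != D2 ->
  [\/ linked F A D1, linked F A D2
    | bottleneck G F D1 D2 /\
      forall D, D \in F -> D != D1 -> D != D2 -> linked F A D].
Proof.
move=> lF hF AF D1F D2F nD.
have other E : E \in F -> bottleneck G F A E ->
    forall D, D \in F -> D != A -> D != E -> linked F A D.
  move=> EF bE D DF nDA nDE; apply: lF; rewrite // 1?eq_sym //.
  by apply: contraNN nDE => bD; apply/eqP; apply: bottleneck_uniq bD bE.
have [e1|n1] := eqVneq D1 A.
  have [b2|/lF l2] := boolP (bottleneck G F A D2).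
    by apply: Or33; rewrite e1; split=> // D; apply: other.
  by apply: Or32; apply: l2; rewrite // -e1.
have [b1|/lF l1] := boolP (bottleneck G F A D1); last first.
  by apply: Or31; apply: l1; rewrite // eq_sym.
have [e2|n2] := eqVneq D2 A; last by apply: Or32; apply: other b1 _ _ _ _; rewrite // eq_sym.
apply: Or33; rewrite e2 bottleneck_sym; split=> // D DF nD1 nDA; exact: other b1 _ _ _ _.
Qed.

(** A singleton family has the one-vertex path; otherwise a partner of [A], if
    any, comes with a further member, which is reachable. *)
Lemma linked_some G F A : linked_off_bottlenecks G F -> homogeneous G F ->
  A \in F -> exists2 C, C \in F & linked F A C.
Proof.
move=> lF hF AF; have [->|] := eqVneq F [set A].
  by exists A; [rewrite set11 | apply: linked1].
move=> nF; have : ~~ (F \subset [set A]).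
  by apply: contraNN nF => sF; rewrite eqEsubset sF sub1set.
case/subsetPn=> C CF; rewrite inE => nCA.
case: (linked_pair lF hF AF AF CF); rewrite 1?eq_sym //.
- by exists A.
- by exists C.
case=> /and5P[_ _ _ _ /and3P[_ _ /exists_inP[X XF nX]]] l; exists X => //.
by apply: l => //; apply: contraNneq nX => ->; rewrite ?subsetUl ?subsetUr.
Qed.

End ShiftedOn.

(** * Cutting a family at an element that separates the ends *)

Section Slices.
Variable n : nat.
Variables (G : {set 'I_n}) (F : {set {set 'I_n}}).
Hypotheses (sF : shifted_on G F) (hF : homogeneous G F).
Implicit Types (A B C D X Y : {set 'I_n}).

Definition below (j : 'I_n) : {set 'I_n} := [set x in G | x < j].

Lemma slice_shifted j b : shifted_on (G :\ j) (slice F j b).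
Proof.
move=> X x y; rewrite !inE => /andP[XF jX] /andP[xj xG] /andP[yj yG] yX xX xy.
by rewrite sF //= ![j == _]eq_sym (negbTE xj) (negbTE yj).
Qed.

Lemma slice_homogeneous j b : homogeneous (G :\ j) (slice F j b).
Proof.
move=> X Y; rewrite !inE => /andP[XF /eqP jX] /andP[YF /eqP jY].
have [eXY /setP eG] := hF XF YF; split=> //; apply/setP=> z.
by have := eG z; rewrite !inE; case: eqVneq => [->|_] //= _; rewrite jX jY.
Qed.

Lemma card_ground X Y : X \in F -> Y \in F -> #|X :&: G| = #|Y :&: G|.
Proof.
move=> XF YF; have [eXY eG] := hF XF YF.
by have := cardsID G X; rewrite eXY eG -(cardsID G Y) => /addIn.
Qed.

Section Cut.
Variable j : 'I_n.
Hypothesis jG : j \in G.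
Hypothesis slices : forall b, linked_off_bottlenecks (G :\ j) (slice F j b).

(** A member [C] containing [j] misses at least two elements below [j], so
    lowering [j] gives two neighbours of [C] in the other slice. *)
Lemma linked_high A B : A \in F -> B \in F -> j \in A -> j \notin B ->
  #|A :&: G| < #|below j| -> linked F A B.
Proof.
move=> AF BF jA jB hj.
have AP : A \in slice F j true by rewrite inE AF jA.
have BQ : B \in slice F j false by rewrite inE BF (negbTE jB).
have [C CP lC] := linked_some (@slices true) (@slice_homogeneous _ _) AP.
have /andP[CF /eqP jC] : (C \in F) && ((j \in C) == true) by rewrite inE in CP.
have /card_gt1P[x [y]] : 1 < #|below j :\: C|.
  have : #|below j :&: C| < #|C :&: G|.
    apply: proper_card; apply/properP; split.
      by apply/subsetP=> z; rewrite !inE => /andP[/andP[-> _] ->].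
    by exists j; rewrite !inE ?jC ?ltnn ?andbF.
  rewrite (card_ground CF AF) => /leq_ltn_trans/(_ hj).
  by rewrite -(cardsID C (below j)) -addn1 ltn_add2l.
rewrite !inE => -[/and3P[xC xG xj] /and3P[yC yG yj] nxy].
have down z : z \notin C -> z \in G -> z < j -> z |: (C :\ j) \in slice F j false.
  move=> zC zG zj; rewrite inE sF // !inE eqxx orbF.
  by case: (eqVneq j z) zj => [->|]; rewrite ?ltnn.
have nxy' : x |: (C :\ j) != y |: (C :\ j).
  apply: contraNneq nxy => /setP/(_ x); rewrite !inE eqxx (negbTE xC) !andbF !orbF.
  by move=> <-.
case: (linked_pair (@slices false) (@slice_homogeneous _ _) BQ
  (down x xC xG xj) (down y yC yG yj) nxy').
- by move=> lB; apply: linked_join lC lB _; apply: adj_swap.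
- by move=> lB; apply: linked_join lC lB _; apply: adj_swap.
(* A third set over the common part of the two is a further neighbour of C. *)
case=> /and5P[/eqP cx _ _ _ /and3P[/forall_inP dich _ /exists_inP[X XQ nX]]] others.
have lB : linked (slice F j false) B X.
  by apply: others => //; apply: contraNneq nX => ->; rewrite ?subsetUl ?subsetUr.
apply: linked_join lC lB _.
have jX : j \notin X by move: XQ; rewrite inE eqbF_neg => /andP[].
apply: (@adj_over _ (C :\ j)); rewrite ?subD1set //.
- have := dich X XQ; rewrite (negbTE nX) orbF; apply: subset_trans.
  by apply/subsetP=> z zC; rewrite inE !(setU1r _ zC).
- by rewrite [LHS](cardsD1 j) jC.
- by have [-> _] := hF CF (subsetP (slice_sub _ _ _) X XQ).
- by apply: contraNneq jX => <-.
Qed.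

(** Dual to [linked_high]: a member [D] avoiding [j] has at least two elements
    above [j], so lowering one of them to [j] gives two neighbours of [D] in the
    other slice. *)
Lemma linked_low A B : A \in F -> B \in F -> j \in A -> j \notin B ->
  (#|below j|).+1 < #|A :&: G| -> linked F A B.
Proof.
move=> AF BF jA jB hj.
have AP : A \in slice F j true by rewrite inE AF jA.
have BQ : B \in slice F j false by rewrite inE BF (negbTE jB).
have [D DQ lD] := linked_some (@slices false) (@slice_homogeneous _ _) BQ.
have /andP[DF /eqP/negbT jD] : (D \in F) && ((j \in D) == false).
  by rewrite inE in DQ.
have /card_gt1P[x [y]] : 1 < #|(D :&: G) :\: below j|.
  have : #|(D :&: G) :&: below j| <= #|below j|.
    by rewrite subset_leq_card ?subsetIr.
  rewrite -ltnS => /leq_ltn_trans/(_ hj).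
  by rewrite -(card_ground DF AF) -(cardsID (below j) (D :&: G)) -addn1 ltn_add2l.
have above z : z \in D -> ~~ ((z \in G) && (z < j)) -> z \in G -> j < z.
  move=> zD + zG; rewrite zG /= -leqNgt leq_eqVlt => /orP[/eqP/val_inj ejz|//].
  by rewrite ejz zD in jD.
rewrite !inE => -[/and3P[hx xD xG] /and3P[hy yD yG] nxy].
have up z : z \in D -> z \in G -> j < z -> j |: (D :\ z) \in slice F j true.
  by move=> zD zG jz; rewrite inE sF // !inE eqxx.
have jx := above x xD hx xG; have jy := above y yD hy yG.
have nxy' : j |: (D :\ x) != j |: (D :\ y).
  apply: contraNneq nxy => /setP/(_ x); rewrite !inE eqxx xD !andbT.
  by case: (x =P j) => [xj|_] /=; [rewrite xj ltnn in jx | move/esym/negbT; rewrite negbK].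
case: (linked_pair (@slices true) (@slice_homogeneous _ _) AP
  (up x xD xG jx) (up y yD yG jy) nxy').
- by move=> lA; apply: linked_join lA lD _; rewrite symdiffC adj_swap.
- by move=> lA; apply: linked_join lA lD _; rewrite symdiffC adj_swap.
(* A third set inside the union of the two is a further neighbour of D. *)
case=> /and5P[_ _ _ _ /and3P[/forall_inP dich /exists_inP[X XP nX] _]] others.
have lA : linked (slice F j true) A X.
  by apply: others => //; apply: contraNneq nX => ->; rewrite ?subsetIl ?subsetIr.
apply: linked_join lA lD _.
have jX : j \in X by move: XP; rewrite inE eqb_id => /andP[].
have [eXD _] := hF (subsetP (slice_sub _ _ _) X XP) DF.
apply: (@adj_under _ (j |: D)); rewrite ?subsetUr //.
- have := dich X XP; rewrite (negbTE nX) => /subset_trans; apply.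
  by rewrite subUset !setUS ?subD1set.
- by rewrite cardsU1 jD eXD.
- by apply: contraNneq jD => <-.
Qed.

End Cut.

(** Let [L] consist of the elements of [A] outside [G] and of the elements of
    [G] below [a], and let [T] be [L] with [a] and [b].  If [A] and [B] do not
    meet in [L], the crossing edge between [b |: L] and [a |: L] avoids both and
    its ends are no partners of [A] and [B].  If they meet in [L], a member that
    neither contains [L] nor lies inside [T] yields a crossing edge; failing
    that, the pair is a bottleneck, or all members contain [L], or all lie
    inside [T]. *)
Lemma linked_middle A B a b : A \in F -> B \in F -> a \in G -> b \in G ->
  a < b -> (forall x : 'I_n, x \in G -> a < x -> b <= x) ->
  a \notin A -> b \in A -> B = a |: (A :\ b) -> (#|below a|).+1 = #|A :&: G| ->
  (forall c, linked_off_bottlenecks (G :\ b) (slice F b c)) ->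
  ~~ bottleneck G F A B -> linked F A B.
Proof.
move=> AF BF aG bG ab next aA bA eB ca slices nbot.
have nab : a != b by apply: contraTneq ab => ->; rewrite ltnn.
have aB : a \in B by rewrite eB setU11.
have bB : b \notin B by rewrite eB !inE eqxx eq_sym (negbTE nab).
have [eAB offAB] := hF AF BF.
pose L := (A :\: G) :|: below a.
have LG x : x \in G -> (x \in L) = (x < a) by move=> xG; rewrite !inE xG.
have LA x : x \notin G -> (x \in L) = (x \in A).
  by move=> xG; rewrite !inE xG (negbTE xG) orbF.
have LB x : x \notin G -> (x \in L) = (x \in B).
  move=> xG; rewrite LA // eB !inE.
  have -> : x == a = false by apply: contraNF xG => /eqP->.
  by have -> : x == b = false by apply: contraNF xG => /eqP->.
have aL : a \notin L by rewrite LG // ltnn.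
have bL : b \notin L by rewrite LG // -leqNgt ltnW.
have cL : #|A| = #|L|.+1.
  rewrite cardsU; have -> : (A :\: G) :&: below a = set0.
    by apply/setP=> x; rewrite !inE; case: (x \in G); rewrite ?andbF.
  by rewrite cards0 subn0 -addnS ca addnC cardsID.
pose T := b |: (a |: L).
have aLG x : x \in G -> (x \in a |: L) = (x <= a).
  by move=> xG; rewrite in_setU1 LG // [RHS]leq_eqVlt.
have TG x : x \in G -> (x \in T) = (x <= b).
  move=> xG; rewrite in_setU1 aLG // [RHS]leq_eqVlt -val_eqE; congr (_ || _).
  apply/idP/idP => [/leq_ltn_trans->//|xb]; rewrite leqNgt; apply/negP=> ax.
  by have := next x xG ax; rewrite leqNgt xb.
have iL : initial G L.
  apply/initialP=> x y + xG yG; rewrite !LG // -leqNgt; exact: leq_trans.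
have iB : initial G (a |: L).
  apply/initialP=> x y + xG yG; rewrite !aLG // -ltnNge; exact: leq_ltn_trans.
have iT : initial G T.
  apply/initialP=> x y + xG yG; rewrite !TG // -ltnNge; exact: leq_ltn_trans.
have inT x : x \in A -> x \notin L -> x \in G by move=> xA; apply: contraNT => /LA->.
have inT' x : x \in B -> x \notin L -> x \in G by move=> xB; apply: contraNT => /LB->.
have inL x : x \in L -> x \notin A -> x \in G by move=> xL; apply: contraNT => /LA<-.
have inL' x : x \in L -> x \notin B -> x \in G by move=> xL; apply: contraNT => /LB<-.
have join X Y : X \in slice F b true -> Y \in slice F b false ->
    (A != X -> ~~ bottleneck (G :\ b) (slice F b true) A X) ->
    (B != Y -> ~~ bottleneck (G :\ b) (slice F b false) B Y) ->
    A != X -> B != Y -> #|symdiff X Y| == 2 -> linked F A B.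
  move=> XP YQ nX nY nAX nBY; apply: (@linked_join _ F b true A B X Y) => //=.
    by apply: slices; rewrite ?nX // inE AF bA.
  by apply: slices; rewrite ?nY // inE BF (negbTE bB).
have [eA|nA] := eqVneq A (b |: L); last first.
  (* Both ends of the edge are members because A and B dominate them. *)
  have CF : b |: L \in F.
    apply: (mem_shift_below sF AF).
    - by rewrite cardsU1 bL cL.
    - apply/setP=> x; rewrite !in_setD in_setU1; case: (boolP (x \in G)) => //= xG.
      by rewrite LA //; case: eqVneq => // e; rewrite e bG in xG.
    move=> x y; rewrite !in_setU1 => /orP[/eqP->|xL] xA yA; first by rewrite bA in xA.
    rewrite negb_or => /andP[_ yL].
    by have xG := inL x xL xA; have yG := inT y yA yL; exact: (initialP _ _ iL).
  have DF : a |: L \in F.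
    apply: (mem_shift_below sF BF).
    - by rewrite cardsU1 aL -eAB cL.
    - apply/setP=> x; rewrite !in_setD in_setU1; case: (boolP (x \in G)) => //= xG.
      by rewrite LB //; case: eqVneq => // e; rewrite e aG in xG.
    move=> x y; rewrite !in_setU1 => /orP[/eqP->|xL] xA yA; first by rewrite aB in xA.
    rewrite negb_or => /andP[_ yL].
    by have xG := inL' x xL xA; have yG := inT' y yA yL; exact: (initialP _ _ iL).
  have nB : B != a |: L.
    apply: contraNneq nA => eBL; apply/eqP/setP=> x; have/setP/(_ x) := eBL.
    rewrite eB !inE -/(below a); case: (eqVneq x b) => [->|nxb] /=; first by rewrite bA.
    by case: eqVneq => [->|] //=; rewrite (negbTE aA) ltnn aG.
  have nLA : ~~ (A \subset b |: L).
    by apply: contraNN nA => sA; rewrite eqEcard sA cardsU1 bL cL leqnn.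
  apply: (join (b |: L) (a |: L)) => //.
  - by rewrite inE CF setU11.
  - by rewrite inE DF in_setU1 [b == a]eq_sym (negbTE nab) (negbTE bL).
  - move=> _; apply: contraNN nLA => /and5P[_ _ _ /initialP iAL _].
    apply/subsetP=> x xA; rewrite in_setU1; case: eqVneq => //= nxb.
    apply: contraT => xL; have xG := inT x xA xL; rewrite LG // in xL.
    have := iAL x a; rewrite !inE xA nxb xG aG (negbTE nab) (negbTE aA) ltnn !andbF.
    by rewrite (negbTE xL) => /(_ isT isT isT isT).
  - move=> _; apply: contraNN nB => /and5P[_ _ /initialP iBL _ _].
    rewrite eq_sym eqEcard cardsU1 aL -eAB cL leqnn andbT subUset sub1set aB /=.
    apply/subsetP=> x xL; apply: contraT => xB; have xG := inL' x xL xB.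
    have nxb : x != b by apply: contraNneq bL => <-.
    have := iBL a x; rewrite !inE aB xG aG nab nxb (negbTE xB) eqxx.
    by rewrite LG // in xL; move/(_ erefl erefl erefl erefl); rewrite ltnNge (ltnW xL).
  apply: (@adj_over _ L); rewrite ?subsetUr // ?cardsU1 ?aL ?bL //.
  apply/eqP=> /setP/(_ b); rewrite !in_setU1 eqxx (negbTE bL) eq_sym.
  by rewrite (negbTE nab).
have {}eB : B = a |: L.
  by rewrite eB eA setU1K.
have eI : A :&: B = L.
  rewrite eA eB -setUIl; apply/setUidPr; apply/subsetP=> x; rewrite !inE.
  by case/andP=> /eqP-> /eqP e; rewrite e eqxx in nab.
have eU : A :|: B = T.
  apply/setP=> x; rewrite eA eB !in_setU1 in_setU !in_setU1.
  by case: (x == a); case: (x == b); case: (x \in L).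
(* Sets of equal size containing L, or inside T, are pairwise adjacent. *)
have clique_over : (forall X, X \in F -> L \subset X) -> linked F A B.
  move=> sub; apply: linked_clique => //; first by apply: contraNneq aA => ->.
  move=> X Y XF YF; apply: (@adj_over _ L); rewrite ?sub //.
    by have [->] := hF XF AF.
  by have [] := hF XF YF.
have clique_under : (forall X, X \in F -> X \subset T) -> linked F A B.
  move=> sub; apply: linked_clique => //; first by apply: contraNneq aA => ->.
  move=> X Y XF YF; apply: (@adj_under _ T); rewrite ?sub //.
    have [-> _] := hF XF AF.
    by rewrite cL !cardsU1 aL in_setU1 eq_sym (negbTE nab) (negbTE bL).
  by have [] := hF XF YF.
have [/exists_inP[X XF]|/exists_inPn dich] :=
    boolP [exists X in F, ~~ (L \subset X) && ~~ (X \subset T)]; last first.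
  have [/exists_inP ex1|/exists_inPn nex1] := boolP [exists X in F, ~~ (L \subset X)].
    have [/exists_inP ex2|/exists_inPn nex2] := boolP [exists X in F, ~~ (X \subset T)].
      case/negP: nbot; rewrite /bottleneck eI eU -cL -eAB !eqxx iL iT /=.
      apply/and3P; split; [|exact/exists_inP..].
      by apply/forall_inP=> X /dich; rewrite negb_and !negbK.
    by apply: clique_under => X /nex2; rewrite negbK.
  by apply: clique_over => X /nex1; rewrite negbK.
(* From here on X misses some i in L and has some c outside T; the edge is to
   join b |: (B :\ i) to c |: (B :\ i), both of which X dominates. *)
case/andP=> /subsetPn[i iL' iX] /subsetPn[c cX cT].
have [cb ca' cL'] : [/\ c != b, c != a & c \notin L].
  by move: cT; rewrite !in_setU1 !negb_or => /and3P.
have iA : i \in A by rewrite eA in_setU1 iL' orbT.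
have iB' : i \in B by rewrite eB in_setU1 iL' orbT.
have iG : i \in G := homog_ground hF AF XF iA iX.
have cA : c \notin A by rewrite eA in_setU1 negb_or cb.
have cB' : c \notin B by rewrite eB in_setU1 negb_or ca'.
have cG : c \in G := homog_ground hF XF AF cX cA.
have ia : i < a by rewrite -LG.
have nia : i != a by apply: contraTneq iL' => ->.
have nib : i != b by apply: contraTneq iL' => ->.
have [eXB offXB] := hF BF XF.
have CF : b |: (B :\ i) \in F.
  apply: (mem_shift_below sF XF); rewrite ?card_swap ?swap_off //.
  move=> x y; rewrite !in_setU1 !in_setD1 => hx xX yX.
  rewrite negb_or negb_and negbK => /andP[yb /orP[/eqP ey|yB]].
    by rewrite ey (negbTE iX) in yX.
  have yG := homog_ground hF XF BF yX yB.
  have yT : y \notin T by rewrite in_setU1 negb_or yb -eB.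
  case/orP: hx => [/eqP ex|/andP[_ xB]].
    by rewrite ex; apply: (initialP _ _ iT); rewrite ?setU11.
  have xG := homog_ground hF BF XF xB xX.
  by apply: (initialP _ _ iT); rewrite // in_setU1 -eB xB orbT.
have DF : c |: (B :\ i) \in F.
  apply: (mem_shift_below sF XF); rewrite ?card_swap ?swap_off //.
  move=> x y; rewrite !in_setU1 !in_setD1 => hx xX yX.
  rewrite negb_or negb_and negbK => /andP[yc /orP[/eqP ey|yB]].
    by rewrite ey (negbTE iX) in yX.
  have yG := homog_ground hF XF BF yX yB.
  case/orP: hx => [/eqP ex|/andP[_ xB]]; first by rewrite ex cX in xX.
  have xG := homog_ground hF BF XF xB xX.
  by apply: (initialP _ _ iB); rewrite // -eB.
(* On the side of B any set without i and with a is reachable: a bottleneck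
   with B would have an intersection containing a but not i < a. *)
have join' Y Z : Y \in slice F b true -> Z \in F -> b \notin Z ->
    i \notin Z -> a \in Z -> A != Y ->
    ~~ bottleneck (G :\ b) (slice F b true) A Y ->
    #|symdiff Y Z| == 2 -> linked F A B.
  move=> YP ZF bZ iZ aZ nAY nY; apply: join => //.
  - by rewrite inE ZF (negbTE bZ).
  - move=> _; apply/negP=> /and5P[_ _ /initialP iBZ _ _].
    have := iBZ a i; rewrite !inE aB aZ aG nab iG nib (negbTE iZ) andbF.
    by move/(_ erefl erefl erefl erefl); rewrite ltnNge (ltnW ia).
  - by apply: contraTneq iB' => ->.
have bC : b \in b |: (B :\ i) by rewrite setU11.
have CP : b |: (B :\ i) \in slice F b true by rewrite inE CF bC.
have nAC : A != b |: (B :\ i).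
  by apply: contraTneq iA => ->; rewrite !inE eqxx (negbTE nib).
have [bAC|nAC'] := boolP (bottleneck (G :\ b) (slice F b true) A (b |: (B :\ i))); last first.
  apply: (join' _ (c |: (B :\ i)) CP) => //.
  - by rewrite !inE negb_or eq_sym cb negb_and bB orbT.
  - by rewrite !inE negb_or eqxx andbT; apply: contraTneq iX => ->; rewrite cX.
  - by rewrite !inE aB [a == i]eq_sym nia orbT.
  apply: (@adj_over _ (B :\ i)); rewrite ?subsetUr ?card_swap //.
    by rewrite [LHS](cardsD1 i) iB'.
  by apply/eqP=> /setP/(_ c); rewrite !inE eqxx (negbTE cb) (negbTE cB') andbF.
(* If b |: (B :\ i) is the partner of A, the bottleneck provides a member Y
   outside the union; it is not the partner, and lowering b to a leads across. *)
case/and5P: (bAC) => _ _ _ _ /and3P[/forall_inP dich' _ /exists_inP[Y YP nY]].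
have /orP[sY|] := dich' Y YP; last by rewrite (negbTE nY).
have /andP[YF bY] : (Y \in F) && (b \in Y) by move: YP; rewrite inE eqb_id.
have nAY : A != Y by apply: contraNneq nY => <-; rewrite subsetUl.
have [eYA _] := hF YF AF.
have LY x : x \in L -> x != i -> x \in Y.
  move=> xL xi; apply: (subsetP sY).
  by rewrite in_setI {1}eA eB !in_setU1 in_setD1 in_setU1 xL xi !orbT.
have iY : i \notin Y.
  apply: contraNN nAY => iY; rewrite eqEcard eYA leqnn andbT eA subUset sub1set bY.
  by apply/subsetP=> x xL; have [->|/(LY x xL)] := eqVneq x i.
have aY : a \notin Y.
  apply: contraNN nY => aY; suff <- : b |: (B :\ i) = Y by rewrite subsetUr.
  apply/eqP; rewrite eqEcard card_swap // eYA eAB leqnn andbT subUset sub1set bY /=.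
  apply/subsetP=> x; rewrite eB in_setD1 in_setU1 => /andP[xi].
  by case/orP=> [/eqP->|/LY] //; apply.
apply: (join' Y (a |: (Y :\ b)) YP).
- exact: sF.
- by rewrite !inE eqxx eq_sym (negbTE nab).
- by rewrite !inE negb_or nia negb_and iY orbT.
- by rewrite setU11.
- exact: nAY.
- apply/negP=> bAY; case/negP: nY.
  rewrite -(bottleneck_uniq (@slice_homogeneous b true) _ CP YP bAC bAY) ?subsetUr //.
  by rewrite inE AF bA.
exact: adj_swap.
Qed.

End Slices.

(** Induction on the size of the family.  If neither [linked_high] nor
    [linked_low] applies at any element separating [A] from [B], all these
    elements have rank [k - 1] or [k] in [G], and there is just one of each. *)
Lemma shifted_on_linked n (G : {set 'I_n}) F :
  shifted_on G F -> homogeneous G F -> linked_off_bottlenecks G F.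
Proof.
have [m] := ubnP #|F|; elim: m G F => // m IH G F lem sF hF A B AF BF nAB nbot.
have slices j (c : bool) : (exists2 X, X \in F & (j \in X) != c) ->
    linked_off_bottlenecks (G :\ j) (slice F j c).
  case=> X XF jX; apply: IH; [|exact: slice_shifted|exact: slice_homogeneous].
  rewrite ltnS in lem; apply: leq_trans lem; apply: proper_card.
  by apply/properP; split; [exact: slice_sub | exists X; rewrite ?inE ?XF].
have slices2 X Y j : X \in F -> Y \in F -> j \in X -> j \notin Y ->
    forall c, linked_off_bottlenecks (G :\ j) (slice F j c).
  move=> XF YF jX jY [] ; apply: slices; first by exists Y; rewrite ?(negbTE jY).
  by exists X; rewrite ?jX.
have cut X Y j : X \in F -> Y \in F -> j \in X -> j \notin Y ->
    (#|below G j| <= #|A :&: G| <= (#|below G j|).+1) \/ linked F X Y.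
  move=> XF YF jX jY; have jG := homog_ground hF XF YF jX jY.
  have cXA := card_ground hF XF AF.
  have [h1|h1] := leqP; last first.
    by right; apply: (linked_high sF hF jG (slices2 X Y j XF YF jX jY)); rewrite ?cXA.
  have [h2|h2] := leqP; last first.
    by right; apply: (linked_low sF hF jG (slices2 X Y j XF YF jX jY)); rewrite ?cXA.
  by left.
have [eAB offAB] := hF A B AF BF.
have below_lt (x y : 'I_n) : x \in G -> x < y -> #|below G x| < #|below G y|.
  move=> xG xy; apply: proper_card; apply/properP; split.
    by apply/subsetP=> z; rewrite !inE => /andP[-> /ltn_trans]; apply.
  by exists x; rewrite !inE xG ?xy // ltnn.
have below_inj x y : x \in G -> y \in G -> #|below G x| = #|below G y| -> x = y.
  move=> xG yG e; apply/val_inj; case: (ltngtP x y) => // lt.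
    by have := below_lt x y xG lt; rewrite e ltnn.
  by have := below_lt y x yG lt; rewrite e ltnn.
have /card_gt0P[b] := diff_gt0 eAB nAB; rewrite inE => /andP[bB bA].
have /card_gt0P[a] : 0 < #|B :\: A| by rewrite -card_diff_eq // diff_gt0.
rewrite inE => /andP[aA aB].
have bG := homog_ground hF AF BF bA bB; have aG := homog_ground hF BF AF aB aA.
have [cb|//] := cut A B b AF BF bA bB.
have [ca|/linked_sym//] := cut B A a BF AF aB aA.
have nab : a != b by apply: contraNneq aA => ->.
have middle X Y x y : X \in F -> Y \in F -> x \in G -> y \in G -> x < y ->
    x \notin X -> y \in X -> Y = x |: (X :\ y) -> ~~ bottleneck G F X Y ->
    #|below G x| <= #|A :&: G| <= (#|below G x|).+1 ->
    #|below G y| <= #|A :&: G| <= (#|below G y|).+1 -> linked F X Y.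
  move=> XF YF xG yG xy xX yX eY nXY cx cy; have lt := below_lt _ _ xG xy.
  have yY : y \notin Y.
    by rewrite eY !inE eqxx orbF; apply: contraTneq xy => ->; rewrite ltnn.
  apply: (linked_middle sF hF XF YF xG yG) => //.
  - move=> z zG xz; rewrite leqNgt; apply/negP=> zy.
    move: (below_lt _ _ xG xz) (below_lt _ _ zG zy) cx cy.
    by move: #|below G x| #|below G y| #|below G z| #|A :&: G|; clear; lia.
  - rewrite (card_ground hF XF AF); move: lt cx cy.
    by move: #|below G x| #|below G y| #|A :&: G|; clear; lia.
  exact: slices2 XF YF yX yY.
have [/exists_inP[x]|/exists_inPn two] :=
    boolP [exists x in symdiff A B, (x != a) && (x != b)].
  rewrite !inE => dx /andP[xa xb].
  have xG : x \in G.
    case/orP: dx => /andP[xY xX]; first exact: homog_ground hF AF BF xX xY.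
    exact: homog_ground hF BF AF xX xY.
  have [cx|//] : (#|below G x| <= #|A :&: G| <= (#|below G x|).+1) \/ linked F A B.
    case/orP: dx => /andP[xY xX]; first exact: cut.
    by case: (cut B A x BF AF xX xY) => [|/linked_sym]; [left|right].
  have nx y : y \in G -> x != y -> #|below G x| != #|below G y|.
    by move=> yG; apply: contraNneq => /(below_inj _ _ xG yG)->.
  have : #|below G a| != #|below G b|.
    by apply: contraNneq nab => /(below_inj _ _ aG bG)->.
  move: (nx a aG xa) (nx b bG xb) ca cb cx.
  by move: #|below G x| #|below G a| #|below G b| #|A :&: G|; clear; lia.
have same x : x != a -> x != b -> (x \in A) = (x \in B).
  move=> xa xb; have := two x; rewrite xa xb !inE.
  by case: (x \in A); case: (x \in B) => //= /(_ erefl).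
have eB : B = a |: (A :\ b).
  apply/setP=> x; rewrite !inE; case: eqVneq => [->|xa] //=.
  by case: eqVneq => [->|xb] /=; [apply: negbTE|rewrite same].
have eA : A = b |: (B :\ a).
  apply/setP=> x; rewrite !inE; case: eqVneq => [->|xb] //=.
  by case: eqVneq => [->|xa] /=; [apply: negbTE|rewrite same].
case: (ltngtP a b) => [ab|ba|/val_inj e].
- exact: (middle A B a b).
- by apply/linked_sym/(middle B A b a); rewrite // bottleneck_sym.
- by rewrite e eqxx in nab.
Qed.

(** * A bottleneck admits no Hamilton path between its ends *)

Section Obstruction.
Variable n : nat.
Implicit Types (A B C D X Y G : {set 'I_n}) (F : {set {set 'I_n}}).

Lemma bottleneck_between G F A B X : bottleneck G F A B -> #|X| = #|A| ->
  A :&: B \subset X -> X \subset A :|: B -> X = A \/ X = B.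
Proof.
case/and5P=> /eqP cA /eqP cB _ _ _ eX sX Xs.
have /card_gt0P[z] : 0 < #|X :\: (A :&: B)|.
  by have := cardsD X (A :&: B); rewrite (setIidPr sX); lia.
rewrite inE => /andP[zI zX].
have closed C : A :&: B \subset C -> #|C| = #|X| -> z \in C -> X = C.
  move=> sC eC zC; have : z |: (A :&: B) = C.
    by apply/eqP; rewrite eqEcard subUset sub1set zC sC cardsU1 zI eC eX -cA leqnn.
  have -> : z |: (A :&: B) = X.
    by apply/eqP; rewrite eqEcard subUset sub1set zX sX cardsU1 zI eX -cA leqnn.
  by [].
have /setUP[zA|zB] := subsetP Xs z zX.
  by left; apply: closed; rewrite ?subsetIl.
by right; apply: closed; rewrite ?subsetIr // eX -cA -cB.
Qed.

(** Away from [A] and [B], being contained in the union is constant along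
    edges: a member outside the union contains the intersection and one inside
    the union does not, so the first has two elements that the second lacks.
    Both kinds occur, yet the inner part of a Hamilton path is connected. *)
Lemma bottleneck_not_linked G F A B : homogeneous G F -> A \in F -> B \in F ->
  bottleneck G F A B -> ~ linked F A B.
Proof.
move=> hF AF BF bot [p [pP lP uP eP]].
case/and5P: (bot) => /eqP cA /eqP cB _ _ /and3P[/forall_inP dich].
case/exists_inP=> X XF nX /exists_inP[Y YF nY].
have inner Z : Z \in F -> ~~ (A :&: B \subset Z) \/ ~~ (Z \subset A :|: B) ->
    Z != A /\ Z != B.
  move=> ZF nZ; split; apply/eqP=> e; rewrite e in nZ.
    by rewrite subsetIl subsetUl in nZ; case: nZ.
  by rewrite subsetIr subsetUr in nZ; case: nZ.
have XT : X \subset A :|: B by have := dich X XF; rewrite (negbTE nX).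
have [[XA XB] [YA YB]] := (inner X XF (or_introl nX), inner Y YF (or_intror nY)).
pose V := F :\ A :\ B.
have side Z W : Z \in V -> W \in V -> #|symdiff Z W| == 2 ->
    ~~ (Z \subset A :|: B) -> ~~ (W \subset A :|: B).
  rewrite !inE => /and3P[ZB ZA ZF] /and3P[WB WA WF] adj nZ; apply/negP=> WT.
  have /subsetPn[c cZ cT] := nZ.
  have /subsetPn[i iS iW] : ~~ (A :&: B \subset W).
    apply/negP=> SW; have [eWA _] := hF _ _ WF AF.
    by case: (bottleneck_between bot eWA SW WT) => e; [rewrite e eqxx in WA|rewrite e eqxx in WB].
  have SZ : A :&: B \subset Z by have := dich Z ZF; rewrite (negbTE nZ) orbF.
  have [eZW _] := hF _ _ ZF WF; move: adj; rewrite (adjE eZW); apply/negP.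
  suff : 1 < #|Z :\: W| by rewrite neq_ltn orbC => ->.
  apply/card_gt1P; exists i, c; split.
  - by rewrite inE iW (subsetP SZ).
  - by rewrite inE cZ andbT; apply: contra cT; apply: (subsetP WT).
  - by apply: contraNneq cT => <-; move: iS; rewrite !inE => /andP[->].
have nAB : A != B by apply/eqP=> e; move: cA; rewrite -e setIid => /esym/n_Sn.
case/lastP: p => [|p Z] in pP lP uP eP; first by rewrite /= in lP; rewrite lP eqxx in nAB.
rewrite last_rcons in lP; subst Z.
have inV Z : (Z \in p) = (Z \in V).
  rewrite !inE -eP inE mem_rcons inE.
  move: uP; rewrite /= rcons_uniq mem_rcons inE negb_or => /and3P[/andP[_ nAp] nBp _].
  case: (eqVneq Z B) => [->|_] /=; first exact: negbTE.
  by case: (eqVneq Z A) => [->|_] /=; first exact: negbTE.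
have Xp : X \in p by rewrite inV !inE XF XA XB.
have Yp : Y \in p by rewrite inV !inE YF YA YB.
have const W q : path (johnson F) W q -> W \in V -> {subset q <= V} ->
    forall Z, Z \in q -> (Z \subset A :|: B) = (W \subset A :|: B).
  elim: q W => //= W' q IH W /andP[/and3P[_ _ adj] pq] WV qV Z.
  have W'V : W' \in V by apply: qV; rewrite mem_head.
  have eW : (W' \subset A :|: B) = (W \subset A :|: B).
    apply: negb_inj; apply/idP/idP; last exact: side.
    by apply: side; rewrite // symdiffC.
  rewrite inE => /predU1P[->//|Zq]; rewrite -eW; apply: (IH W') => //.
  by move=> U Uq; apply: qV; rewrite inE Uq orbT.
case: p => // W q in pP inV Xp Yp {uP eP}.
move: pP; rewrite /= rcons_path => /and3P[_ pq _].
have cst Z : Z \in W :: q -> (Z \subset A :|: B) = (W \subset A :|: B).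
  rewrite inE => /predU1P[->//|]; apply: const pq _ _ _; first by rewrite -inV mem_head.
  by move=> U Uq; rewrite -inV inE Uq orbT.
by move: nY; rewrite (cst Y Yp) -(cst X Xp) XT.
Qed.

End Obstruction.

(** * Bottlenecks of shifted families are universal pairs of Y-families *)

Section YFamilies.
Variables n k : nat.
Implicit Types (A B S X Y : {set 'I_n}) (F : {set {set 'I_n}}).

Lemma in_seg m (x : 'I_n) : (x \in seg n m) = (x < m).
Proof. by rewrite inE. Qed.

Lemma card_seg m : m <= n -> #|seg n m| = m.
Proof.
move=> mn; have inj : injective (widen_ord mn) by move=> x y /(congr1 val) /= /val_inj.
rewrite -[RHS](card_ord m) -(card_imset predT inj).
apply: eq_card => x; rewrite in_seg; apply/idP/imsetP => [xm|[y _ ->] //=].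
by exists (Ordinal xm) => //; apply: val_inj.
Qed.

Lemma initial_seg m : initial [set: 'I_n] (seg n m).
Proof. by apply/initialP=> x y; rewrite !in_seg -leqNgt => xm _ _; apply: leq_trans. Qed.

Lemma initial_setT_seg S m : initial [set: 'I_n] S -> #|S| = m -> S = seg n m.
Proof.
move=> iS cS; apply: initial_uniq iS (initial_seg m) _ _; last by rewrite !setDT.
by rewrite card_seg // -cS -[leqRHS]card_ord max_card.
Qed.

Lemma uniform_homogeneous F : uniform k F -> homogeneous [set: 'I_n] F.
Proof. by move=> uF X Y XF YF; rewrite !uF // !setDT. Qed.

Lemma shifted_shifted_on F : shifted F -> shifted_on [set: 'I_n] F.
Proof. by case=> _ sF X i j XF _ _ jX iX ij; apply: sF. Qed.

Definition univ0 := seg n k.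
Definition univ1 := seg n k.-1 :|: [set x : 'I_n | lbl x == k.+1].

Hypothesis k_gt1 : 1 < k.
Hypothesis k_ltn : k.+2 <= n.

Lemma in_univ1 (x : 'I_n) : (x \in univ1) = (x < k.-1) || (x == k :> nat).
Proof. by rewrite !inE eqSS. Qed.

Lemma univI : univ0 :&: univ1 = seg n k.-1.
Proof. apply/setP=> x; rewrite in_setI in_univ1 !in_seg; lia. Qed.

Lemma univU : univ0 :|: univ1 = seg n k.+1.
Proof. apply/setP=> x; rewrite in_setU in_univ1 !in_seg; lia. Qed.

Lemma Yfam_bottleneck F r s : k.+2 <= r <= n -> 1 <= s <= k.-1 ->
  uniform k F -> F = Yfam n k r s -> bottleneck [set: 'I_n] F univ0 univ1.
Proof.
move=> hr hs uF eF.
have inF X : (X \in F) = [|| (X == univ0) || (X == univ1),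
    X \in [set seg n k.-1 :|: [set a] | a : 'I_n & k.+2 <= lbl a <= r]
  | X \in [set seg n k.+1 :\ i | i : 'I_n & s <= lbl i <= k.-1]].
  by rewrite eF /Yfam /universal_pair !in_setU !in_set1 orbA.
have U0F : univ0 \in F by rewrite inF eqxx.
have U1F : univ1 \in F by rewrite inF eqxx orbT.
have ra : r.-1 < n by lia.
have si : s.-1 < n by lia.
rewrite /bottleneck univI univU (uF _ U0F) (uF _ U1F) card_seg ?initial_seg; last by lia.
rewrite prednK ?eqxx /=; last by lia.
apply/and3P; split.
- apply/forall_inP=> X; rewrite inF => /or3P[/orP[]/eqP->|/imsetP[a _ ->]|/imsetP[i _ ->]].
  + by rewrite -univI subsetIl.
  + by rewrite -univI subsetIr.
  + by rewrite subsetUl.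
  + by rewrite subD1set orbT.
- apply/exists_inP; exists (seg n k.+1 :\ Ordinal si).
    rewrite inF; apply/or3P/Or33/imsetP; exists (Ordinal si) => //.
    by rewrite inE /lbl /=; lia.
  apply/subsetPn; exists (Ordinal si); rewrite ?in_seg /=; first by lia.
  by rewrite !inE eqxx.
- apply/exists_inP; exists (seg n k.-1 :|: [set Ordinal ra]).
    rewrite inF; apply/or3P/Or32/imsetP; exists (Ordinal ra) => //.
    by rewrite inE /lbl /=; lia.
  apply/subsetPn; exists (Ordinal ra); rewrite ?in_setU ?in_set1 ?eqxx ?orbT //.
  rewrite in_seg /=; lia.
Qed.

Lemma bottleneck_universal_pair F A B : uniform k F -> A \in F ->
  A :&: B = seg n k.-1 -> A :|: B = seg n k.+1 ->
  bottleneck [set: 'I_n] F A B -> [set A; B] = [set univ0; univ1].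
Proof.
move=> uF AF eI eU bot.
have c1 : #|univ1| = k.
  have := cardsUI univ0 univ1; rewrite univI univU !card_seg; lia.
have c0 : #|univ0| = k by rewrite card_seg //; lia.
have n01 : univ0 != univ1.
  apply/eqP=> e; have := univI; rewrite -e setIid => /(congr1 (fun S => #|S|)).
  rewrite !card_seg; lia.
have [e0|e0] : univ0 = A \/ univ0 = B.
  apply: bottleneck_between bot _ _ _; rewrite ?eI ?eU -?univI -?univU.
  - by rewrite c0 uF.
  - exact: subsetIl.
  - exact: subsetUl.
all: have [e1|e1] : univ1 = A \/ univ1 = B;
  first by apply: bottleneck_between bot _ _ _; rewrite ?eI ?eU -?univI -?univU;
    [rewrite c1 uF | exact: subsetIr | exact: subsetUr].
- by rewrite e0 e1 eqxx in n01.
- by rewrite e0 e1.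
- by rewrite e0 e1 setUC.
- by rewrite e0 e1 eqxx in n01.
Qed.

(** The parameter [r] is the largest label of an element added to the
    intersection, and [s] the least label of one removed from the union;
    shifting fills in all the intermediate values. *)
Lemma bottleneck_Yfam F : uniform k F -> shifted F ->
  univ0 \in F -> univ1 \in F ->
  bottleneck [set: 'I_n] F univ0 univ1 ->
  exists r s, [/\ k.+2 <= r <= n, 1 <= s <= k.-1 & F = Yfam n k r s].
Proof.
move=> uF sF U0F U1F.
case/and5P=> _ _ _ _; rewrite univI univU.
set S := seg n k.-1; set T := seg n k.+1.
case/and3P=> /forall_inP dich /exists_inP[X XF nX] /exists_inP[Y YF nY].
have cS : #|S| = k.-1 by rewrite card_seg //; lia.
have cT : #|T| = k.+1 by rewrite card_seg //; lia.
have over Z z : Z \in F -> S \subset Z -> z \in Z -> z \notin S -> Z = S :|: [set z].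
  move=> ZF SZ zZ zS; apply/esym/eqP.
  by rewrite eqEcard subUset sub1set SZ zZ uF // setUC cardsU1 zS cS add1n prednK ?leqnn // ltnW.
have under Z z : Z \in F -> Z \subset T -> z \in T -> z \notin Z -> Z = T :\ z.
  move=> ZF ZT zT zZ; apply/eqP.
  rewrite eqEcard subsetD1 ZT zZ (uF _ ZF); have := cardsD1 z T.
  by rewrite zT cT add1n => -[<-]; rewrite leqnn.
have inS x : (x \in S) = (x < k.-1) by rewrite in_seg.
have inT x : (x \in T) = (x <= k) by rewrite in_seg ltnS.
have leS x : x < k.-1 -> x <= k by move: k_gt1; clear; lia.
have ltS x : k < x -> (x < k.-1) = false by move: k_gt1; clear; lia.
pose P (c : 'I_n) := (S :|: [set c] \in F) && (k < c).
pose Q (i : 'I_n) := (T :\ i \in F) && (i < k.-1).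
have [c0 Pc0] : exists c, P c.
  have /subsetPn[c cY cT'] := nY; exists c.
  have kc : k < c by move: cT'; rewrite inT -ltnNge.
  have SY : S \subset Y by have := dich Y YF; rewrite (negbTE nY) orbF.
  by rewrite /P -(over Y c) ?YF // inS ltS.
have [i0 Qi0] : exists i, Q i.
  have /subsetPn[i iS iX] := nX; exists i.
  have ik : i < k.-1 by move: iS; rewrite inS.
  have XT : X \subset T by have := dich X XF; rewrite (negbTE nX).
  by rewrite /Q -(under X i) ?XF // inT leS.
pose r := [arg max_(c > c0 | P c) val c]; pose s := [arg min_(i < i0 | Q i) val i].
have [Pr rmax] : P r /\ forall c, P c -> c <= r.
  by rewrite /r; case: arg_maxnP.
have [Qs smin] : Q s /\ forall i, Q i -> s <= i.
  by rewrite /s; case: arg_minnP.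
have [/andP[rF kr] /andP[sF' sk]] := (Pr, Qs).
exists r.+1, s.+1; split.
- by rewrite !ltnS kr ltn_ord.
- by rewrite ltnS sk.
apply/setP=> Z; rewrite /Yfam /universal_pair !in_setU !in_set1 -orbA.
apply/idP/idP=> [ZF|].
  have [SZ|nSZ] := boolP (S \subset Z).
    have /card_gt0P[z] : 0 < #|Z :\: S|.
      by rewrite cardsD (setIidPr SZ) uF // cS; move: k_gt1; clear; lia.
    rewrite inE => /andP[zS zZ]; have eZ := over Z z ZF SZ zZ zS.
    move: (zS); rewrite inS -leqNgt => kz.
    have [kz'|] := ltnP k z.
      have /rmax zr : P z by rewrite /P -eZ ZF.
      by apply/or3P/Or32/imsetP; exists z => //; rewrite inE /lbl !ltnS kz' zr.
    move=> zk; apply/or3P/Or31/orP.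
    have [nz|nz] := eqVneq (z : nat) k;
      [right; apply/eqP; change (Z = univ1)|left; apply/eqP]; apply/setP=> x;
      rewrite eZ ?in_univ1 in_setU in_set1 inS ?in_seg -val_eqE /=;
      move: kz zk nz k_gt1; clear; lia.
  have ZT : Z \subset T by have := dich Z ZF; rewrite (negbTE nSZ).
  have /subsetPn[i iS iZ] := nSZ; move: (iS); rewrite inS => ik.
  have eZ : Z = T :\ i by apply: under => //; rewrite inT leS.
  have /smin si : Q i by rewrite /Q -eZ ZF.
  by apply/or3P/Or33/imsetP; exists i => //; rewrite inE /lbl ltnS si ik.
case/or3P=> [/orP[]/eqP->//|/imsetP[a]|/imsetP[i]]; rewrite inE /lbl => /andP[h1 h2] ->.
- have [->//|nar] := eqVneq a r.
  have -> : S :|: [set a] = a |: ((S :|: [set r]) :\ r).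
    by rewrite setUC [_ :|: [set r]]setUC setU1K // inS ltS.
  apply: sF.2 => //.
  + by rewrite in_setU set11 orbT.
  + by rewrite /lbl; move: nar h2; rewrite -val_eqE /=; clear; lia.
  + by rewrite in_setU in_set1 inS (negbTE nar) orbF ltS.
- have [->//|nis] := eqVneq i s.
  have -> : T :\ i = s |: ((T :\ s) :\ i).
    apply/setP=> x; rewrite in_setU1 !in_setD1 -/T.
    by have [->|_] //= := eqVneq x s; rewrite eq_sym nis inT leS.
  apply: sF.2 => //.
  + by rewrite in_setD1 nis inT leS.
  + by rewrite /lbl; move: nis h1; rewrite -val_eqE /=; clear; lia.
  + by rewrite !inE eqxx.
Qed.

End YFamilies.

Lemma set2_eq (T : finType) (a b c d : T) : a != b -> [set a; b] = [set c; d] ->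
  (a = c /\ b = d) \/ (a = d /\ b = c).
Proof.
move=> nab e.
have : a \in [set c; d] by rewrite -e set21.
have : b \in [set c; d] by rewrite -e set22.
rewrite !in_set2 => /orP[]/eqP eb /orP[]/eqP ea.
- by rewrite ea eb eqxx in nab.
- by right.
- by left.
- by rewrite ea eb eqxx in nab.
Qed.

Lemma Y_family_bottleneck n k (F : {set {set 'I_n}}) A B : 0 < k -> k <= n ->
  uniform k F -> shifted F -> A \in F -> B \in F -> A != B ->
  (Y_family k F /\ [set A; B] = universal_pair n k) <->
  bottleneck [set: 'I_n] F A B.
Proof.
move=> k_gt0 kn uF sF AF BF nAB; split.
  case=> -[k_gt1 [r [s [hr hs eF]]]] eAB.
  have k_ltn : k.+2 <= n by case/andP: hr; apply: leq_trans.
  have bot := Yfam_bottleneck k_gt1 k_ltn hr hs uF eF.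
  have [[-> ->]|[-> ->]] := set2_eq nAB (eAB : _ = [set univ0 n k; univ1 n k]) => //.
  by rewrite bottleneck_sym.
move=> bot; case/and5P: (bot) => /eqP cA _ iI iU /and3P[_].
have cI : #|A :&: B| = k.-1 by rewrite -(uF A AF) -cA.
have cU : #|A :|: B| = k.+1.
  apply/eqP; rewrite -(eqn_add2r #|A :&: B|) cardsUI (uF A AF) (uF B BF) cI.
  by rewrite addSnnS prednK.
have eI := initial_setT_seg iI cI; have eU := initial_setT_seg iU cU.
case/exists_inP=> X _ /subsetPn[i + _]; rewrite eI in_seg => ik.
case/exists_inP=> Y _ /subsetPn[c _]; rewrite eU in_seg -leqNgt => kc.
have k_gt1 : 1 < k by move: ik; clear; lia.
have k_ltn : k.+2 <= n := leq_ltn_trans kc (ltn_ord c).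
have eAB := bottleneck_universal_pair k_gt1 k_ltn uF AF eI eU bot.
split; last exact: eAB.
split=> //; apply: bottleneck_Yfam => //.
- by have [[<- _]|[_ <-]] := set2_eq nAB eAB.
- by have [[_ <-]|[<- _]] := set2_eq nAB eAB.
- by have [[<- <-]|[<- <-]] := set2_eq nAB eAB; rewrite // bottleneck_sym.
Qed.

Theorem theorem1p2 (n k : nat) (hk : 1 <= k) (hkn : k <= n)
    (F : {set {set 'I_n}}) (hunif : uniform k F) (hF : shifted F)
    (A B : {set 'I_n}) (hA : A \in F) (hB : B \in F) (hAB : A <> B) :
  (~ (Y_family k F /\ [set A; B] = universal_pair n k) ->
     has_hamilton_path F (johnson F) A B) /\
  (Y_family k F /\ [set A; B] = universal_pair n k ->
     ~ has_hamilton_path F (johnson F) A B).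
Proof.
have hU := uniform_homogeneous hunif.
have nAB : A != B by apply/eqP.
have Yb := Y_family_bottleneck hk hkn hunif hF hA hB nAB.
split=> [nY|/Yb bot]; last exact: bottleneck_not_linked hU hA hB bot.
apply: (shifted_on_linked (shifted_shifted_on hF) hU) => //.
by apply/negP=> /Yb.
Qed.
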